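(* Let $G$ be a finitely generated group that is not torsion, i.e. some $g \in G$ has infinite order. Then for every finite field $K$ there is a Lie algebraic $G$-subshift $X$ over $K$ which is not cellwiseable and whose co-homoclinic factor $X/\overline{\Delta_X}$ is isomorphic to (the additive group of) $K$.
   Context: Let $G$ be a group and $A$ a finite alphabet. The full shift $A^G$ has the product topology and the left shift action $(gx)_h = x_{g^{-1}h}$. A $G$-subshift is a closed $G$-invariant subset $X \subset A^G$. A block code $f : X \to Y$ between $G$-subshifts $X \subset A^G$, $Y \subset B^G$ is a continuous $G$-equivariant map; equivalently, there are a finite set $N \subset G$ (a neighborhood of $f$) and a local function $F : A^N \to B$ with $f(x)_g = F((g^{-1}x)|_N)$. Finite powers $X^n$ are regarded as subshifts of $(A^n)^G$, so $n$-ary block codes $X^n \to X$ make sense (for $n = 0$, a $G$-invariant element of $X$). A topological conjugacy is a bijective block code. A Lie algebraic $G$-subshift over a finite field $K$ is a $G$-subshift $X$ equipped with block codes for the zero element $0$ (nullary), scalar multiplication $x \mapsto ax$ for each $a \in K$, addition $(x,y) \mapsto x+y$ and a bracket $(x,y) \mapsto [x,y]$, which make $X$ a Lie algebra over $K$ (the bracket is bilinear, satisfies $[x,x]=0$ and the Jacobi identity). It is cellwise if each of these operations admits $\{1_G\}$ as a neighborhood. It is cellwiseable if there is a cellwise Lie algebraic $G$-subshift $Y$ over $K$ and a topological conjugacy $\phi : X \to Y$ that is also an isomorphism of Lie algebras over $K$. A point $x \in X$ is homoclinic if $gx \to 0$ as $g$ escapes finite subsets of $G$; $\Delta_X$ is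 the subgroup of $(X,+)$ of all homoclinic points, and the co-homoclinic factor is the quotient $X/\overline{\Delta_X}$ by its closure. *)

(* Defs.v *)
From HB Require Import structures.
From mathcomp Require Import all_boot all_order all_algebra finmap.
From mathcomp Require Import ring_quotient.
From mathcomp Require Import all_classical topology.

Set Implicit Arguments.
Unset Strict Implicit.
Unset Printing Implicit Defensive.

Import GRing.Theory.

Local Open Scope fset_scope.
Local Open Scope classical_set_scope.
Local Open Scope ring_scope.

Definition finitely_generated (G : groupType) : Prop :=
  exists S : {fset G},
    smallest (fun H : set G => group_closed (mem H)) [set` S] = [set: G].

Definition infinite_order (G : groupType) (g : G) : Prop :=
  forall n : nat, (0 < n)%N -> (g ^+ n)%g <> 1%g.

(* [g --> oo] in a discrete group: g eventually leaves every finite subset. *)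
Definition cofinite (T : Type) : set_system T :=
  [set S | finite_set (~` S)].
Arguments cofinite T : clear implicits.

Instance cofinite_filter (T : Type) : Filter (cofinite T).
Proof.
split.
- by rewrite /cofinite /= setCT; exact: finite_set0.
- by move=> P Q; rewrite /cofinite /= setCI finite_setU.
- by move=> P Q PQ; rewrite /cofinite /=; apply: sub_finite_set; exact: subsetC.
Qed.

Notation full_shift G A := (prod_topology (fun _ : G => discrete_topology A)).

Definition shift (G : groupType) (A : finType) (g : G) (x : full_shift G A) :
  full_shift G A := fun h => x (g^-1 * h)%g.

Record subshift (G : groupType) (A : finType) := Subshift {
  subshift_set : set (full_shift G A);
  subshift_closed : closed subshift_set;
  subshift_shift : forall g x, subshift_set x -> subshift_set (shift g x) }.

(* [set_type] carries the topology induced by the one of the full shift. *)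
Notation points X := (set_type (subshift_set X)).

Definition shift_points (G : groupType) (A : finType) (X : subshift G A)
    (g : G) (x : points X) : points X :=
  exist _ (shift g (val x))
    (mem_set (subshift_shift g (set_mem (valP x)))).

Section block_codes.
Context {G : groupType} {A B : finType} {X : subshift G A} {Y : subshift G B}.

Definition block_code (f : points X -> points Y) : Prop :=
  continuous f /\ forall g x, f (shift_points g x) = shift_points g (f x).

Definition has_neighborhood (f : points X -> points Y) (N : {fset G}) : Prop :=
  exists F : {ffun N -> A} -> B, forall (x : points X) (g : G),
    val (f x) g = F [ffun h : N => shift g^-1%g (val x) (val h)].

Definition conjugacy (f : points X -> points Y) : Prop :=
  block_code f /\ bijective f.

End block_codes.

Lemma ptws_cvg (G : Type) (C : choiceType) (T : Type) (F : set_system T)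
    {FF : Filter F} (f : T -> full_shift G C) (x : full_shift G C) :
  (forall g, \forall t \near F, f t g = x g) -> f @ F --> x.
Proof.
move=> fx; apply/cvg_sup => g U /= [_ [[W oW <-] /= Wx]] WU.
rewrite nbhs_filterE /=; apply: filterS (fx g) => t ftx.
by apply: WU; rewrite /= ftx.
Qed.

Lemma ptws_near (G : eqType) (C : choiceType) (x : full_shift G C) (g : G) :
  \forall y \near x, y g = x g.
Proof.
have /(_ x) := @proj_continuous G (fun _ : G => discrete_topology C) g.
by move=> /(_ [set x g]); apply; exact: discrete_set1.
Qed.

(* A configuration over the alphabet A^n encodes n configurations over A. *)
Definition track (G : groupType) (A : finType) n (i : 'I_n)
  (z : full_shift G {ffun 'I_n -> A}) : full_shift G A := fun g => z g i.

Lemma track_continuous (G : groupType) (A : finType) n (i : 'I_n) :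
  continuous (@track G A n i).
Proof.
move=> z; apply: (ptws_cvg (FF := nbhs_filter z)) => g.
apply: (@filterS _ _ (nbhs_filter z) _ _ _ (ptws_near z g)) => y yz.
by rewrite /track yz.
Qed.

Section powers.
Context {G : groupType} {A : finType} (X : subshift G A) (n : nat).

Definition power_set : set (full_shift G {ffun 'I_n -> A}) :=
  [set z | forall i, subshift_set X (track i z)].

Lemma power_closed : closed power_set.
Proof.
have -> : power_set =
    \bigcap_(i in [set: 'I_n]) (@track G A n i @^-1` subshift_set X).
  by apply/seteqP; split=> z /= zX i; [move=> _|]; exact: zX.
apply: closed_bigI => i _.
apply: closed_comp; last exact: subshift_closed.
by move=> z _; exact: track_continuous.
Qed.

Lemma power_shift g z : power_set z -> power_set (shift g z).
Proof. by move=> zX i; exact: (subshift_shift g (zX i)). Qed.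

Definition power : subshift G {ffun 'I_n -> A} :=
  Subshift power_closed power_shift.

Definition power_coord (i : 'I_n) (z : points power) : points X :=
  exist _ (track i (val z)) (mem_set (set_mem (valP z) i)).

End powers.

(* A constant and a binary operation on X, seen as maps X^0 -> X and
   X^2 -> X. *)
Definition nullary (G : groupType) (A : finType) (X : subshift G A)
  (c : points X) : points (power X 0) -> points X := fun _ => c.

Definition binary (G : groupType) (A : finType) (X : subshift G A)
    (f : points X -> points X -> points X) : points (power X 2) -> points X :=
  fun z => f (power_coord ord0 z) (power_coord ord_max z).

Record lie_algebra_axioms (K : nzRingType) (V : Type) (zero : V)
    (scale : K -> V -> V) (add bracket : V -> V -> V) : Prop :=
  LieAlgebraAxioms {
    lie_addA : associative add;
    lie_addC : commutative add;
    lie_add0 : left_id zero add;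
    (* the opposite is not an operation of the structure *)
    lie_addN : forall x, exists y, add y x = zero;
    lie_scaleA : forall a b x, scale a (scale b x) = scale (a * b) x;
    lie_scale1 : left_id 1 scale;
    lie_scaleDr : right_distributive scale add;
    lie_scaleDl : forall x, {morph scale^~ x : a b / a + b >-> add a b};
    lie_bracketl : forall a x y z,
      bracket (add (scale a x) y) z = add (scale a (bracket x z)) (bracket y z);
    lie_bracketr : forall a x y z,
      bracket z (add (scale a x) y) = add (scale a (bracket z x)) (bracket z y);
    lie_bracketxx : forall x, bracket x x = zero;
    lie_jacobi : forall x y z,
      add (add (bracket x (bracket y z)) (bracket y (bracket z x)))
          (bracket z (bracket x y)) = zero }.

Record lie_subshift (G : groupType) (K : finFieldType) := LieSubshift {
  lie_alphabet : finType;
  lie_underlying :> subshift G lie_alphabet;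
  lie_zero : points lie_underlying;
  lie_scale : K -> points lie_underlying -> points lie_underlying;
  lie_add :
    points lie_underlying -> points lie_underlying -> points lie_underlying;
  lie_bracket :
    points lie_underlying -> points lie_underlying -> points lie_underlying;
  lie_zero_code : block_code (nullary lie_zero);
  lie_scale_code : forall a, block_code (lie_scale a);
  lie_add_code : block_code (binary lie_add);
  lie_bracket_code : block_code (binary lie_bracket);
  lie_axioms : lie_algebra_axioms lie_zero lie_scale lie_add lie_bracket }.

Section lie_module.
Context {G : groupType} {K : finFieldType}.
Implicit Type X : lie_subshift G K.

(* Alias of [points X] carrying the [K]-module structure of [X]. *)
Definition lie_points X : Type := points X.

HB.instance Definition _ X := Topological.copy (lie_points X) (points X).

Lemma lie_opp_subproof X :
  left_inverse (lie_zero X) (lie_scale (-1)) (@lie_add _ _ X).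
Proof.
move=> x; have ax := lie_axioms X.
rewrite -{2}(lie_scale1 ax x) -(lie_scaleDl ax) addNr.
have [y y0] := lie_addN ax (lie_scale 0 x).
rewrite -[LHS](lie_add0 ax) -y0 -(lie_addA ax); congr (lie_add y _).
by rewrite -(lie_scaleDl ax) addr0.
Qed.

HB.instance Definition _ X := GRing.isZmodule.Build (lie_points X)
  (lie_addA (lie_axioms X)) (lie_addC (lie_axioms X))
  (lie_add0 (lie_axioms X)) (@lie_opp_subproof X).

HB.instance Definition _ X := GRing.Zmodule_isLmodule.Build K (lie_points X)
  (lie_scaleA (lie_axioms X)) (lie_scale1 (lie_axioms X))
  (lie_scaleDr (lie_axioms X)) (lie_scaleDl (lie_axioms X)).

Record cellwise X : Prop := Cellwise {
  cellwise_zero : has_neighborhood (nullary (lie_zero X)) [fset 1%g];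
  cellwise_scale : forall a : K,
    has_neighborhood (lie_scale (l := X) a) [fset 1%g];
  cellwise_add : has_neighborhood (binary (@lie_add _ _ X)) [fset 1%g];
  cellwise_bracket :
    has_neighborhood (binary (@lie_bracket _ _ X)) [fset 1%g] }.

Definition lie_isomorphism X Y (f : lie_points X -> lie_points Y) : Prop :=
  [/\ bijective f, linear f &
      {morph f : x y / lie_bracket x y >-> lie_bracket x y}].

Definition cellwiseable X : Prop :=
  exists2 Y : lie_subshift G K, cellwise Y &
    exists2 f : points X -> points Y, conjugacy f & lie_isomorphism f.

Definition homoclinic X : set (lie_points X) :=
  [set x | (fun g : G => shift_points g x : lie_points X) @ cofinite G -->
           (0 : lie_points X)].
Arguments homoclinic X : clear implicits.

Definition homoclinic_closure X : {pred lie_points X} :=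
  mem (closure (homoclinic X)).
Arguments homoclinic_closure X : clear implicits.

Definition pair_track X (p : lie_points X * lie_points X) :
    full_shift G {ffun 'I_2 -> lie_alphabet X} :=
  fun g => [ffun i => if i == ord0 then val p.1 g else val p.2 g].

Lemma track_pair0 X p : track ord0 (@pair_track X p) = val p.1.
Proof. by apply/funext => g; rewrite /track ffunE. Qed.

Lemma track_pair1 X p : track ord_max (@pair_track X p) = val p.2.
Proof. by apply/funext => g; rewrite /track ffunE. Qed.

Lemma pair_track_power X p :
  @pair_track X p \in subshift_set (power (lie_underlying X) 2).
Proof.
apply/mem_set => i; case: (eqVneq i ord0) => [->|i0].
  by rewrite track_pair0; exact/set_mem/valP.
have -> : i = ord_max by apply/val_inj; case: i i0 => -[|[|]].
by rewrite track_pair1; exact/set_mem/valP.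
Qed.

Definition pair_points X (p : lie_points X * lie_points X) :
  points (power (lie_underlying X) 2) := 
  exist _ (pair_track p) (pair_track_power p).

Lemma lie_points_near X (x : lie_points X) (g : G) :
  \forall y \near x, val y g = val x g.
Proof.
have := @initial_continuous (points X) _ set_val x.
by move=> /(_ _ (ptws_near (val x) g)).
Qed.

Lemma pair_points_continuous X : continuous (@pair_points X).
Proof.
apply: continuous_comp_initial => p.
apply: (ptws_cvg (FF := nbhs_filter p)) => g.
have n1 : \forall u \near p, val u.1 g = val p.1 g.
  exact: (cvg_fst (F := nbhs p.1) (G := nbhs p.2) (lie_points_near p.1 g)).
have n2 : \forall u \near p, val u.2 g = val p.2 g.
  exact: (cvg_snd (F := nbhs p.1) (G := nbhs p.2) (lie_points_near p.2 g)).
apply: filterS2 n1 n2 => u u1 u2.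
by apply/ffunP => i; rewrite /= set_valE /= !ffunE u1 u2.
Qed.

Lemma binary_pair X (f : points X -> points X -> points X)
  (p : lie_points X * lie_points X) : binary f (pair_points p) = f p.1 p.2.
Proof.
by rewrite /binary; congr f; apply/val_inj; rewrite /= (track_pair0, track_pair1).
Qed.

Lemma lie_add_continuous X :
  continuous (fun p : lie_points X * lie_points X => p.1 + p.2).
Proof.
have -> : (fun p : lie_points X * lie_points X => p.1 + p.2) =
    binary (@lie_add _ _ X) \o @pair_points X.
  by apply/funext => p /=; rewrite binary_pair.
move=> p; apply: continuous_comp; first exact: pair_points_continuous.
exact: (lie_add_code X).1.
Qed.

Lemma lie_sub_continuous X :
  continuous (fun p : lie_points X * lie_points X => p.1 - p.2).
Proof.
move=> [x y].
apply: (@continuous2_cvg _ _ _ _ (nbhs (x, y)) _ fst (fun p => - p.2)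
  (fun a b : lie_points X => a + b)).
- exact: (@lie_add_continuous X (x, - y)).
- exact: cvg_fst.
- apply: (cvg_comp _ _ cvg_snd).
  exact: ((lie_scale_code X (-1)).1 y).
Qed.

Lemma shift_lie0 X g : shift_points g (0 : lie_points X) = 0 :> lie_points X.
Proof.
have z : points (power (lie_underlying X) 0).
  exists (fun _ => [ffun i : 'I_0 => val (lie_zero X) 1%g]).
  by apply/mem_set => -[].
by rewrite -((lie_zero_code X).2 g z).
Qed.

Lemma shift_lieB X g (x y : lie_points X) :
  shift_points g (x - y) =
  (shift_points g x : lie_points X) - (shift_points g y : lie_points X).
Proof.
have shN : - (shift_points g y : lie_points X) = shift_points g (- y).
  exact: (lie_scale_code X (-1)).2.
rewrite shN; have := (lie_add_code X).2 g (pair_points (x, - y)).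
rewrite binary_pair => <-.
have -> : shift_points g (pair_points (x, - y)) =
    pair_points (shift_points g x, shift_points g (- y)).
  apply/val_inj/funext => h; apply/ffunP => i.
  by rewrite /= /shift !ffunE.
by rewrite binary_pair.
Qed.

Lemma homoclinic_closure_zmod_closed X : zmod_closed (homoclinic_closure X).
Proof.
split.
  apply/mem_set/subset_closure; rewrite /homoclinic /=.
  under eq_fun do rewrite shift_lie0.
  exact: cvg_cst.
move=> x y /set_mem clx /set_mem cly; apply/mem_set => U Uxy.
have [[V W] /= [Vx Wy] VWU] := @lie_sub_continuous X (x, y) _ Uxy.
have [x' [hx Vx']] := clx _ Vx; have [y' [hy Wy']] := cly _ Wy.
exists (x' - y'); split; last exact: (VWU (x', y')).
rewrite /homoclinic /=.
under eq_fun do rewrite shift_lieB.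
have -> : nbhs (0 : lie_points X) = nbhs (0 - 0 : lie_points X).
  by rewrite subr0.
apply: (@continuous2_cvg _ _ _ _ (cofinite G) _ _ _
  (fun a b : lie_points X => a - b)) => //.
exact: (@lie_sub_continuous X (0, 0)).
Qed.

HB.instance Definition _ X :=
  GRing.isZmodClosed.Build (lie_points X) (homoclinic_closure X)
    (@homoclinic_closure_zmod_closed X).

Definition cohomoclinic_factor X := Quotient.quot (homoclinic_closure X).
HB.instance Definition _ X := GRing.Zmodule.on (cohomoclinic_factor X).

End lie_module.

Arguments homoclinic {G K} X _.
Arguments homoclinic_closure {G K} X.

(* Main.v *)
(** Let g have infinite order. Take X = K^G x K, where the second factor
   consists of constant configurations, with the bracket
   [(v, c), (w, d)] = (c Dw - d Dv, 0) where (Dv)_h = v_(hg); the map D commutes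
   with the left shift. As G is infinite, the homoclinic points are the (v, 0)
   with v of finite support, and X modulo their closure is K.
   If f is an isomorphism onto a cellwise Y, the points x with f(x)_1 = 0 form
   an open ideal, so the v with (v, 0) in it form an open subspace W of K^G,
   and DW is contained in W since (Dv, 0) = [(0, 1), (v, 0)]. Now W contains all
   v vanishing on some finite F, and then all v vanishing on F g^-n. For some n
   the sets F and F g^-n are disjoint, hence W = K^G, and f vanishes on K^G x 0
   by equivariance. *)
From HB Require Import structures.
Require Import Defs.
From mathcomp Require Import all_boot all_order all_algebra finmap.
From mathcomp Require Import ring_quotient ring.
From mathcomp Require Import all_classical topology.

Set Implicit Arguments.
Unset Strict Implicit.
Unset Printing Implicit Defensive.

Import GRing.Theory.

Local Open Scope classical_set_scope.
Local Open Scope quotient_scope.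
Local Open Scope ring_scope.

(** * Topology of subshift points: cylinders and continuity *)

Lemma points_near (G : groupType) (A : finType) (X : subshift G A)
    (x : points X) (g : G) :
  \forall y \near x, val y g = val x g.
Proof.
have := @initial_continuous (points X) _ set_val x.
by move=> /(_ _ (ptws_near (val x) g)).
Qed.

Section subshift_points.
Context {G : groupType} {A : finType} {X : subshift G A}.

Lemma points_cvg (T : Type) (F : set_system T) {FF : Filter F}
    (f : T -> points X) (x : points X) :
  (forall g, \forall t \near F, val (f t) g = val x g) -> f @ F --> x.
Proof.
move=> fx U [_ /= [[W oW <-]] Wx WU].
apply: (@filterS _ F _ _ _ (fun t Wt => WU (f t) Wt)).
apply: (@ptws_cvg G A T F FF (fun t => val (f t)) (val x) fx).
exact: open_nbhs_nbhs.
Qed.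

(** The cylinders around [x] form a filter base, and the filter they generate converges to [x] by
    the coordinatewise criterion; hence it contains every neighborhood of [x]. *)
Lemma nbhs_cylinder (x : points X) (U : set (points X)) : nbhs x U ->
  exists F : {fset G}, forall y : points X,
    (forall g, g \in F -> val y g = val x g) -> U y.
Proof.
pose C (F : {fset G}) :=
  [set y : points X | forall g, g \in F -> val y g = val x g].
have C_filter : Filter (filter_from setT C).
  apply: filter_from_filter; first by exists fset0.
  move=> E F _ _; exists (E `|` F)%fset => // y EFy.
  by split=> g gEF; apply: EFy; rewrite inE gEF ?orbT.
have idx : id @ filter_from setT C --> x.
  apply: points_cvg => g; exists [fset g]%fset => // y; apply.
  exact: fset11.
by move=> /idx [F _ FU]; exists F => y Fy; exact: FU.
Qed.

(** The window [F] may depend on [g]: the operations below read the constant component at [1],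
    whatever the position. *)
Lemma binary_block_code (op : points X -> points X -> points X) :
  (forall g, exists F : {fset G}, forall x y x' y' : points X,
    (forall h, h \in F -> val x h = val x' h) ->
    (forall h, h \in F -> val y h = val y' h) ->
    val (op x y) g = val (op x' y') g) ->
  (forall g x y, op (shift_points g x) (shift_points g y) =
     shift_points g (op x y)) ->
  block_code (binary op).
Proof.
move=> op_local op_shift; split=> [z|g z]; last first.
  by rewrite /binary -op_shift; congr op; exact/val_inj.
apply: (points_cvg (FF := nbhs_filter z)) => g.
have [F opF] := op_local g.
have zF : nbhs z (\bigcap_(h in [set` F]) [set w | val w h = val z h]).
  have zFilter := nbhs_filter z.
  by apply: filter_bigI => h _; exact: points_near.
apply: (@filterS _ _ (nbhs_filter z) _ _ _ zF) => w wF.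
by apply: opF => h hF; have /= := wF h hF; rewrite /track => ->.
Qed.

End subshift_points.

(** * Locality of cellwise operations *)

Lemma neighborhood1_local (G : groupType) (A B : finType) (X : subshift G A)
    (Y : subshift G B) (f : points X -> points Y) (x y : points X) (g : G) :
  has_neighborhood f [fset 1%g]%fset -> val x g = val y g ->
  val (f x) g = val (f y) g.
Proof.
move=> [F fE] xy; rewrite !fE; congr F; apply/ffunP => h; rewrite !ffunE.
by case: h => h /=; rewrite inE => /eqP ->; rewrite /shift invgK mulg1.
Qed.

Lemma binary_local (G : groupType) (K : finFieldType) (X : lie_subshift G K)
    (f : points X -> points X -> points X) (x y x' y' : points X) (g : G) :
  has_neighborhood (binary f) [fset 1%g]%fset ->
  val x g = val x' g -> val y g = val y' g ->
  val (f x y) g = val (f x' y') g.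
Proof.
move=> f1 xx' yy'.
rewrite -(binary_pair f (x, y)) -(binary_pair f (x', y')).
apply: neighborhood1_local f1 _.
by apply/ffunP => i; rewrite /= !ffunE /= xx' yy'.
Qed.

Lemma lie_bracket0 (G : groupType) (K : finFieldType) (X : lie_subshift G K)
    (x : lie_points X) : lie_bracket x (0 : lie_points X) = 0 :> lie_points X.
Proof.
pose b : lie_points X := lie_bracket x (0 : lie_points X).
have : lie_bracket x (-1 *: 0 + 0 : lie_points X) = -1 *: b + b.
  exact: (lie_bracketr (lie_axioms X)).
by rewrite scaler0 addr0 scaleN1r addNr.
Qed.

(** * Elements of infinite order *)

Lemma expg_inj (G : groupType) (g : G) :
  infinite_order g -> injective (fun n : nat => g ^+ n)%g.
Proof.
move=> g_inf m n; wlog mn : m n / (m <= n)%N.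
  by move=> H; case: (leqP m n) => [/H//|/ltnW /H K /esym/K].
move=> /= gmn; apply/eqP; rewrite eqn_leq mn /= leqNgt.
apply/negP => lt_mn; apply: (g_inf (n - m)%N); first by rewrite subn_gt0.
by apply: (mulgI (g ^+ m)%g); rewrite -expgnDr subnKC // mulg1 -gmn.
Qed.

(** Pigeonhole: the first [#|S| + 1] powers of [g] are distinct, so they cannot all lie in [S]. *)
Lemma expg_notin (G : groupType) (g : G) (S : {fset G}) :
  infinite_order g -> exists n : nat, (g ^+ n)%g \notin S.
Proof.
move=> g_inf; apply: contrapT => gS.
have : (size [seq (g ^+ n)%g | n <- iota 0 #|` S|.+1] <= #|` S|)%N.
  apply: uniq_leq_size.
    by rewrite map_inj_uniq ?iota_uniq //; exact: expg_inj.
  move=> _ /mapP [n _ ->]; apply/negPn/negP => gnS.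
  by apply: gS; exists n.
by rewrite size_map size_iota ltnn.
Qed.

Lemma cofinite_exists (G : groupType) (g : G) (P : set G) :
  infinite_order g -> (\forall k \near cofinite G, P k) -> exists k, P k.
Proof.
move=> g_inf /finite_fsetP [S SP].
have [n gnS] := expg_notin S g_inf; exists (g ^+ n)%g.
apply: contrapT => nP; move/negP: gnS; apply.
suff : [set` S] (g ^+ n)%g by [].
by rewrite -SP.
Qed.

(** * The Lie algebraic subshift on K^G x K *)

Section twisted_shift.
Variables (G : groupType) (K : finFieldType) (g : G).

Definition twist_set : set (full_shift G (K * K)%type) :=
  [set x | forall h, (x h).2 = (x 1%g).2].

(** Each equation of [twist_set] involves only the coordinates [h] and [1], at which a close enough
    point of the set agrees with [x]. *)
Lemma twist_closed : closed twist_set.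
Proof.
move=> x clx h.
have xh1 : \forall y \near x, y h = x h /\ y 1%g = x 1%g.
  apply: (@filterS2 _ (nbhs x) (nbhs_filter x) _ _ _ _
    (ptws_near x h) (ptws_near x 1%g)).
  by move=> y.
have [y [Xy [yh y1]]] := clx _ xh1.
by rewrite -yh -y1 Xy.
Qed.

Lemma twist_shift k x : twist_set x -> twist_set (shift k x).
Proof. by move=> Xx h; rewrite /shift Xx [RHS]Xx. Qed.

Definition twist_subshift : subshift G (K * K)%type :=
  Subshift twist_closed twist_shift.
Local Notation X := (points twist_subshift).

Lemma twist_point_subproof (v : G -> K) (c : K) :
  (fun h => (v h, c)) \in subshift_set twist_subshift.
Proof. exact/mem_set. Qed.

Definition twist_point (v : G -> K) (c : K) : X :=
  exist _ (fun h => (v h, c)) (twist_point_subproof v c).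

Definition body (x : X) (h : G) : K := (val x h).1.
Definition height (x : X) : K := (val x 1%g).2.

Lemma twist_pointE x : x = twist_point (body x) (height x).
Proof.
apply/val_inj/funext => h; rewrite /= [LHS]surjective_pairing.
by congr pair; exact: (set_mem (valP x)).
Qed.

Lemma twist_eqP x y :
  (forall h, body x h = body y h) -> height x = height y -> x = y.
Proof.
by move=> /funext b c; rewrite (twist_pointE x) (twist_pointE y) b c.
Qed.

Lemma body_shift k x h : body (shift_points k x) h = body x (k^-1 * h)%g.
Proof. by []. Qed.

Lemma height_shift k x : height (shift_points k x) = height x.
Proof. exact: (set_mem (valP x)). Qed.

Lemma body_near x h : \forall y \near x, body y h = body x h.
Proof. by apply: filterS (points_near x h) => y yx; rewrite /body yx. Qed.

Lemma height_near x : \forall y \near x, height y = height x.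
Proof. by apply: filterS (points_near x 1%g) => y yx; rewrite /height yx. Qed.

Definition twist_zero : X := twist_point (fun _ => 0) 0.
Definition twist_scale (a : K) x : X :=
  twist_point (fun h => a * body x h) (a * height x).
Definition twist_add x y : X :=
  twist_point (fun h => body x h + body y h) (height x + height y).
(** Semidirect product: K acts on the abelian ideal K^G through right translation by [g], which
    commutes with the left shift. *)
Definition twist_bracket x y : X :=
  twist_point
    (fun h => height x * body y (h * g)%g - height y * body x (h * g)%g) 0.

Lemma body_bracket x y h : body (twist_bracket x y) h =
  height x * body y (h * g)%g - height y * body x (h * g)%g.
Proof. by []. Qed.

Lemma twist_zero_code : block_code (nullary twist_zero).
Proof.
split; first exact: cst_continuous.
by move=> k z; apply: twist_eqP => [h|]; rewrite ?height_shift.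
Qed.

Lemma twist_scale_code a : block_code (twist_scale a).
Proof.
split=> [x|k x].
  apply: (points_cvg (FF := nbhs_filter x)) => h.
  by apply: filterS2 (body_near x h) (height_near x) => y /= -> ->.
by apply: twist_eqP => [h|]; rewrite ?height_shift //= /height /= height_shift.
Qed.

Lemma twist_add_code : block_code (binary twist_add).
Proof.
apply: binary_block_code => [h|k x y].
  exists [fset h; 1%g]%fset => x y x' y' xx' yy'.
  have [xh yh] : val x h = val x' h /\ val y h = val y' h.
    by rewrite xx' ?yy' // !inE eqxx.
  have [x1 y1] : val x 1%g = val x' 1%g /\ val y 1%g = val y' 1%g.
    by rewrite xx' ?yy' // !inE eqxx orbT.
  by rewrite /= /body /height xh yh x1 y1.
by apply: twist_eqP => [h|]; rewrite ?height_shift //= /height /= !height_shift.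
Qed.

Lemma twist_bracket_code : block_code (binary twist_bracket).
Proof.
apply: binary_block_code => [h|k x y].
  exists [fset (h * g)%g; 1%g]%fset => x y x' y' xx' yy'.
  have [xh yh] : val x (h * g)%g = val x' (h * g)%g /\
      val y (h * g)%g = val y' (h * g)%g.
    by rewrite xx' ?yy' // !inE eqxx.
  have [x1 y1] : val x 1%g = val x' 1%g /\ val y 1%g = val y' 1%g.
    by rewrite xx' ?yy' // !inE eqxx orbT.
  by rewrite /= /body /height xh yh x1 y1.
apply: twist_eqP => [h|]; last by rewrite height_shift.
by rewrite body_shift !body_bracket !height_shift !body_shift !mulgA.
Qed.

(** Both projection rules in one pair, so that a single rewrite computes the coordinates in all the
    axioms. *)
Let coordE v c :=
  (fun h => erefl : body (twist_point v c) h = v h,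
   erefl : height (twist_point v c) = c).

Lemma twist_axioms :
  lie_algebra_axioms twist_zero twist_scale twist_add twist_bracket.
Proof.
rewrite /twist_zero /twist_scale /twist_add /twist_bracket.
split.
- by move=> x y z; apply: twist_eqP => [h|]; rewrite !coordE addrA.
- by move=> x y; apply: twist_eqP => [h|]; rewrite !coordE addrC.
- by move=> x; apply: twist_eqP => [h|]; rewrite !coordE add0r.
- move=> x; exists (twist_scale (-1) x).
  by apply: twist_eqP => [h|]; rewrite !coordE mulN1r addNr.
- by move=> a b x; apply: twist_eqP => [h|]; rewrite !coordE mulrA.
- by move=> x; apply: twist_eqP => [h|]; rewrite !coordE mul1r.
- by move=> a x y; apply: twist_eqP => [h|]; rewrite !coordE mulrDr.
- by move=> x a b; apply: twist_eqP => [h|]; rewrite !coordE mulrDl.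
- by move=> a x y z; apply: twist_eqP => [h|]; rewrite !coordE; ring.
- by move=> a x y z; apply: twist_eqP => [h|]; rewrite !coordE; ring.
- by move=> x; apply: twist_eqP => [h|]; rewrite !coordE ?subrr.
- by move=> x y z; apply: twist_eqP => [h|]; rewrite !coordE; ring.
Qed.

Definition twist_lie : lie_subshift G K :=
  LieSubshift twist_zero_code twist_scale_code twist_add_code
    twist_bracket_code twist_axioms.

Lemma lie_addE (x y : lie_points twist_lie) : x + y = twist_add x y.
Proof. by []. Qed.

Lemma height_is_additive :
  zmod_morphism (fun x : lie_points twist_lie => height x).
Proof.
move=> x y; have : height (x - y + y) = height (x - y) + height y by [].
by rewrite subrK => ->; rewrite addrK.
Qed.

(** * Homoclinic points and the co-homoclinic factor *)

Hypothesis g_inf : infinite_order g.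

(** The height is locally constant and shift-invariant, so a single shift of [x] close to zero
    already determines it. *)
Lemma twist_homoclinic_height (x : lie_points twist_lie) :
  homoclinic twist_lie x -> height x = 0.
Proof.
move=> x0; have [k xk] := cofinite_exists g_inf (x0 _ (height_near twist_zero)).
by rewrite -(height_shift k x).
Qed.

Lemma twist_finite_homoclinic (F : {fset G}) (v : G -> K) :
  (forall h, h \notin F -> v h = 0) -> homoclinic twist_lie (twist_point v 0).
Proof.
move=> vF; apply: points_cvg => h.
(* The shift by [k] can be nonzero at [h] only if [k^-1 * h] lies in [F], that is, [k] lies in h
   F^-1. *)
have : finite_set ((fun k => h * k^-1)%g @` [set` F]).
  exact/finite_image/finite_fset.
apply: sub_finite_set => k /= nvk; exists (k^-1 * h)%g; last first.
  by rewrite invgM invgK mulVKg.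
apply: contrapT => /negP kF; apply: nvk.
by rewrite /shift vF.
Qed.

Lemma twist_homoclinic_closure (x : lie_points twist_lie) :
  (x \in homoclinic_closure twist_lie) = (height x == 0).
Proof.
apply/idP/eqP => [/set_mem clx|hx].
  have [y [/twist_homoclinic_height hy <-]] := clx _ (height_near x).
  by rewrite hy.
apply/mem_set => U /nbhs_cylinder [F FU].
(* Truncating [x] to [F] gives a homoclinic point in the same cylinder. *)
exists (twist_point (fun h => if h \in F then body x h else 0) 0); split.
  by apply: (@twist_finite_homoclinic F) => h /negPf ->.
by apply: FU => h hF; rewrite [in RHS](twist_pointE x) hx /= hF.
Qed.

Definition coheight (q : cohomoclinic_factor twist_lie) : K := height (repr q).

(** Two representatives differ by an element of the closure, which is the kernel of [height]. *)
Lemma coheight_pi (x : lie_points twist_lie) :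
  coheight (\pi_(cohomoclinic_factor twist_lie) x) = height x.
Proof.
apply/esym/eqP; rewrite -subr_eq0 -height_is_additive -twist_homoclinic_closure.
by rewrite Quotient.idealrBE reprK.
Qed.

Lemma coheight_is_additive : zmod_morphism coheight.
Proof.
move=> p q.
have -> : p - q = \pi_(cohomoclinic_factor twist_lie) (repr p - repr q).
  by rewrite raddfB /= !reprK.
by rewrite coheight_pi; exact: height_is_additive.
Qed.

Lemma coheight_bij : bijective coheight.
Proof.
exists (fun c =>
  \pi_(cohomoclinic_factor twist_lie) (twist_point (fun _ => 0) c)).
  move=> q; rewrite -[RHS]reprK; apply/eqP.
  rewrite -Quotient.idealrBE twist_homoclinic_closure.
  by rewrite height_is_additive subrr.
by move=> c; rewrite coheight_pi.
Qed.

(** * Failure of cellwiseability *)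

Lemma twist_not_cellwiseable : ~ cellwiseable twist_lie.
Proof.
move=> [Y cY [f [[fc fs] _] [/bij_inj finj f_lin f_bracket]]].
(* The alphabet of [Y] has no algebraic structure of its own, so vanishing at [1] means agreeing
   there with the zero point. *)
pose W (x : lie_points twist_lie) := val (f x) 1%g = val (0 : lie_points Y) 1%g.
have f0 : f (0 : lie_points twist_lie) = (0 : lie_points Y).
  have := f_lin (-1) (0 : lie_points twist_lie) (0 : lie_points twist_lie).
  by rewrite scaler0 addr0 scaleN1r addNr.
have fD (x y : lie_points twist_lie) :
    f (x + y) = (f x : lie_points Y) + (f y : lie_points Y).
  by have := f_lin 1 x y; rewrite !scale1r.
have WD x y : W x -> W y -> W (x + y).
  move=> Wx Wy; rewrite /W fD -[0 in RHS](addr0 (0 : lie_points Y)).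
  exact: (binary_local (cellwise_add cY) Wx Wy).
(* At [1] the bracket depends only on the symbols at [1], so [f x] may be replaced by 0. *)
have W_bracket t x : W x -> W (lie_bracket t x).
  move=> Wx; rewrite /W f_bracket -(lie_bracket0 (f t)).
  exact: (binary_local (cellwise_bracket cY) erefl Wx).
have [F FW] : exists F : {fset G}, forall y : lie_points twist_lie,
    (forall h, h \in F -> val y h = val (0 : lie_points twist_lie) h) -> W y.
  apply: nbhs_cylinder; rewrite /W -f0.
  exact: (fc (0 : lie_points twist_lie) _ (points_near (f _) 1%g)).
have FW0 v : (forall h, h \in F -> v h = 0) -> W (twist_point v 0).
  by move=> vF; apply: FW => h hF; rewrite /= vF.
have W_translate n v :
    W (twist_point v 0) -> W (twist_point (fun h => v (h * g ^+ n)%g) 0).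
  elim: n v => [|n IHn] v Wv.
    by under [X in twist_point X]funext do rewrite expg0 mulg1.
  under [X in twist_point X]funext do rewrite expgSr mulgA.
  apply: (IHn (fun h => v (h * g)%g)).
  (* Bracketing with (0, 1) is right translation by [g], and [W] is stable under it. *)
  have <- : twist_bracket (twist_point (fun _ => 0) 1) (twist_point v 0) =
      twist_point (fun h => v (h * g)%g) 0.
    apply: twist_eqP => [h|//].
    by rewrite body_bracket !coordE mul1r mul0r subr0.
  exact: W_bracket.
have W0 v : W (twist_point v 0).
  (* With g^n outside F^-1 F, the sets F and F g^n are disjoint. Split [v] into [v1], vanishing on
     [F], and [v2], supported in [F]; the latter is the n-fold translate of a configuration
     supported in F g^n, hence vanishing on [F]. *)
  have [n gnF] := expg_notin [fset (h^-1 * k)%g | h in F, k in F]%fset g_inf.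
  pose v1 h := if h \in F then 0 else v h.
  pose v2 h := if h \in F then v h else 0.
  have -> : twist_point v 0 =
      (twist_point v1 0 : lie_points twist_lie) + twist_point v2 0.
    apply: twist_eqP => [h|]; rewrite lie_addE /twist_add !coordE ?addr0 //.
    by rewrite /v1 /v2; case: ifP; rewrite (add0r, addr0).
  apply: WD; first by apply: FW0 => h; rewrite /v1 => ->.
  have -> : v2 = fun h => (v2 (h * g ^+ n * (g ^+ n)^-1))%g.
    by apply/funext => h; rewrite mulgK.
  apply: (W_translate n (fun h => v2 (h * (g ^+ n)^-1)%g)).
  apply: FW0 => h hF; rewrite /v2; case: ifP => // hgF.
  case/negP: gnF; apply/imfset2P; exists (h * (g ^+ n)^-1)%g => //.
  by exists h => //; rewrite invgM invgK mulgVK.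
(* The constant configuration 1 is shift-invariant, so the vanishing of its image at [1] spreads to
   every coordinate; injectivity of [f] then forces 1 = 0 in K. *)
have : twist_point (fun _ => 1) 0 = (0 : lie_points twist_lie).
  apply: finj; rewrite f0; apply/val_inj/funext => h.
  have shiftE (y : lie_points Y) :
      val y h = val (shift_points h^-1 y : lie_points Y) 1%g.
    by rewrite /= /shift invgK mulg1.
  have shift1 :
      shift_points h^-1 (twist_point (fun _ => 1) 0) =
      twist_point (fun _ => 1) 0.
    exact/val_inj.
  rewrite !shiftE shift_lie0 -fs shift1.
  exact: W0.
by move/(congr1 (fun x => body x 1%g))/eqP; rewrite oner_eq0.
Qed.

End twisted_shift.

Theorem corollary16 (G : groupType) (G_fg : finitely_generated G)
    (G_not_torsion : exists g : G, infinite_order g) (K : finFieldType) :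
  exists2 X : lie_subshift G K,
    ~ cellwiseable X &
    exists f : {additive cohomoclinic_factor X -> K}, bijective f.
Proof.
have [g g_inf] := G_not_torsion.
exists (twist_lie K g); first exact: twist_not_cellwiseable.
pose m := GRing.isZmodMorphism.Build _ _ _
  (coheight_is_additive (K := K) g_inf).
pose f : {additive cohomoclinic_factor (twist_lie K g) -> K} :=
  HB.pack (@coheight G K g) m.
by exists f; exact: coheight_bij.
Qed.
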